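(* Let $G_n=K_{n_1}(u_0=v_0)S_{n_2}$ be a generalized starlike tree with $n=n_1+n_2-1$ vertices, let $m$ be the degree of the root in $S_{n_2}$, let $t_1$ be the length of a longest branch of $S_{n_2}$, and let $t_2$ be the length of a longest branch after deleting one longest branch of $S_{n_2}$. Let $g(k)=\prod_{i=1}^{k}(n_1-i)$ and $f(j)=m-\sum_{i=1}^{j-1}L_i$. For $0\le h\le \max\{t_1+n_1-1,\,t_1+t_2\}$, the number $P_h(G_n)$ of paths with length $h$ in $G_n$ is as follows. (0) $P_0(G_n)=n_1+n_2-1$; $\;P_1(G_n)=\frac{n_1(n_1-1)}{2}+n_2-1$; $\;P_2(G_n)=\frac12m^2+\left(n_1-\frac52\right)m+\frac12n_1^3-\frac32n_1^2+n$. For $h\ge3$: (1) If $t_2<n_1-1$ and $n_1-1\le t_1<t_1+t_2$: $$P_h(G_n)=\begin{cases}P_h(K_{n_1})+P_h(S_{n_2})+\sum_{k=1}^{h-1}g(k)f(h-k), & 3\le h\le n_1-1,\\ P_h(S_{n_2})+\sum_{k=1}^{n_1-1}g(k)f(h-k), & n_1\le h\le t_1+t_2,\\ \sum_{k=1}^{n_1-1}g(k)f(h-k), & t_1+t_2+1\le h\le t_1+n_1-1.\end{cases}$$ (2) If $t_2\le t_1<n_1-1\le t_1+t_2$: $$P_h(G_n)=\begin{cases}P_h(K_{n_1})+P_h(S_{n_2})+\sum_{k=1}^{h-1}f(k)g(h-k), & 3\le h\le t_1,\\ P_h(K_{n_1})+P_h(S_{n_2})+\sum_{k=1}^{t_1}f(k)g(h-k),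 & t_1+1\le h\le n_1-1,\\ P_h(S_{n_2})+\sum_{k=1}^{t_1}f(k)g(h-k), & n_1\le h\le t_1+t_2,\\ \sum_{k=1}^{t_1}f(k)g(h-k), & t_1+t_2+1\le h\le t_1+n_1-1.\end{cases}$$ (3) If $t_1+t_2<n_1-1$: $$P_h(G_n)=\begin{cases}P_h(K_{n_1})+P_h(S_{n_2})+\sum_{k=1}^{h-1}f(k)g(h-k), & 3\le h\le t_1,\\ P_h(K_{n_1})+P_h(S_{n_2})+\sum_{k=1}^{t_1}f(k)g(h-k), & t_1+1\le h\le t_1+t_2,\\ P_h(K_{n_1})+\sum_{k=1}^{t_1}f(k)g(h-k), & t_1+t_2+1\le h\le n_1-1,\\ \sum_{k=1}^{t_1}f(k)g(h-k), & n_1\le h\le t_1+n_1-1.\end{cases}$$ (4) If $n_1-1\le t_2$: $$P_h(G_n)=\begin{cases}P_h(K_{n_1})+P_h(S_{n_2})+\sum_{k=1}^{h-1}g(k)f(h-k), & 3\le h\le n_1-1,\\ P_h(S_{n_2})+\sum_{k=1}^{n_1-1}g(k)f(h-k), & n_1\le h\le t_1+n_1-1,\\ P_h(S_{n_2}), & t_1+n_1\le h\le t_1+t_2.\end{cases}$$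
   Context: Graphs are finite and simple. A path of length $h$ in $G$ is a subgraph that is a path with $h$ edges ($h+1$ distinct vertices); paths are undirected, and paths of length $0$ are single vertices. $P_h(G)$ is the number of paths of length $h$ in $G$ ($0$ if $h$ exceeds the length of a longest path of $G$). A starlike tree is a tree with exactly one vertex $v_0$ of degree greater than $2$, called its root; a branch of length $l$ ($l$-branch) is a path of length $l$ from $v_0$ to a pendant vertex, and $L_l$ is the number of $l$-branches ($L_l=0$ if there are none). The generalized starlike tree $G_n=K_{n_1}(u_0=v_0)S_{n_2}$ is obtained from the disjoint union of the complete graph $K_{n_1}$ on $n_1$ vertices and a starlike tree $S_{n_2}$ on $n_2$ vertices by identifying a vertex $u_0$ of $K_{n_1}$ with the root $v_0$ of $S_{n_2}$ into a single vertex $x_0$. The quantity $g(k)$ is the number of paths of length $k$ in $K_{n_1}$ having $x_0$ as an end-vertex, and $f(j)$ is the number of paths of length $j$ in $S_{n_2}$ having $x_0$ as an end-vertex; $L_i$ refers to the branches of $S_{n_2}$. *)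

(* Defs.v *)
From mathcomp Require Import all_boot all_order all_algebra.
Set Implicit Arguments.
Unset Strict Implicit.
Unset Printing Implicit Defensive.

Record sgraph := SGraph {
  vertex :> finType;
  adj : rel vertex;
  adj_sym : symmetric adj;
  adj_irr : irreflexive adj }.

Definition degree (G : sgraph) (x : G) : nat := #|[set y | adj x y]|.

(* A subgraph is a pair (vertex set, edge set), edges being unordered pairs. *)
Definition subgraph (G : sgraph) : finType :=
  ({set G} * {set {set G}})%type.

Definition listed_subgraph (G : sgraph) (s : seq G) : subgraph G :=
  ([set x in s], [set [set p.1; p.2] | p in zip s (behead s)]).

Definition lists_path (G : sgraph) (s : seq G) : bool :=
  uniq s && sorted (@adj G) s.

(* Paths are undirected: the two listings of a path of positive length give
   the same subgraph, hence a single element of [paths G h]. *)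
Definition paths (G : sgraph) (h : nat) : {set subgraph G} :=
  [set listed_subgraph t | t : h.+1.-tuple G & lists_path t].

Definition num_paths (G : sgraph) (h : nat) : nat := #|paths G h|.

(* Paths having [x] as an end-vertex: those with a listing that starts at [x]
   (the end-vertices are the first and last entries, and a listing can be
   reversed). *)
Definition paths_from (G : sgraph) (x : G) (h : nat) : {set subgraph G} :=
  [set listed_subgraph t | t : h.+1.-tuple G & lists_path t && (thead t == x)].

Definition path_length (G : sgraph) (P : subgraph G) : nat := #|P.2|.

Definition connected_graph (G : sgraph) : Prop :=
  0 < #|G| /\ forall x y : G, connect (@adj G) x y.

(* [ucycle] also accepts the degenerate [:: x; y] with [x], [y] adjacent. *)
Definition acyclic (G : sgraph) : Prop :=
  forall c : seq G, ucycle (@adj G) c -> size c <= 2.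

Definition is_tree (G : sgraph) : Prop := connected_graph G /\ acyclic G.

Definition starlike_tree (S : sgraph) (v0 : S) : Prop :=
  is_tree S /\ forall x : S, 2 < degree x <-> x = v0.

Definition branches_of_length (S : sgraph) (v0 : S) (l : nat) :
    {set subgraph S} :=
  [set listed_subgraph t | t : l.+1.-tuple S
     & [&& lists_path t, thead t == v0 & degree (tnth t ord_max) == 1]].

Definition num_branches (S : sgraph) (v0 : S) (l : nat) : nat :=
  #|branches_of_length v0 l|.

Definition branches (S : sgraph) (v0 : S) : {set subgraph S} :=
  \bigcup_(l < #|S|) branches_of_length v0 l.

Definition longest_branch (S : sgraph) (v0 : S) (B : subgraph S) : Prop :=
  B \in branches v0 /\
  forall B', B' \in branches v0 -> path_length B' <= path_length B.

Section Complete.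
Variable n : nat.

Definition complete_adj : rel 'I_n := fun x y => x != y.

Lemma complete_adj_sym : symmetric complete_adj.
Proof. by move=> x y; rewrite /complete_adj eq_sym. Qed.

Lemma complete_adj_irr : irreflexive complete_adj.
Proof. by move=> x; rewrite /complete_adj eqxx. Qed.

Definition complete_graph : sgraph := SGraph complete_adj_sym complete_adj_irr.

End Complete.

(* The disjoint union of [G] and [H] with [u] and [v] identified: the merged
   vertex is represented by [inl u], and the vertices of [H] other than [v]
   by [inr]. *)
Section Coalescence.
Variables (G H : sgraph) (u : G) (v : H).

Definition coal_vertex : finType := (G + {x : H | x != v})%type.

Definition coal_adj : rel coal_vertex := fun a b =>
  match a, b with
  | inl x, inl y => adj x y
  | inr x, inr y => adj (val x) (val y)
  | inl x, inr y => (x == u) && adj v (val y)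
  | inr x, inl y => (y == u) && adj (val x) v
  end.

Lemma coal_adj_sym : symmetric coal_adj.
Proof. by move=> [x|x] [y|y] /=; rewrite adj_sym. Qed.

Lemma coal_adj_irr : irreflexive coal_adj.
Proof. by move=> [x|x] /=; rewrite adj_irr. Qed.

Definition coalescence : sgraph := SGraph coal_adj_sym coal_adj_irr.

End Coalescence.

(* Main.v *)
(** A path of the coalescence lies in one of the two graphs or crosses from one
    to the other through the merged vertex [x0]; in the latter case it splits
    at [x0] into a path of each graph ending there.  Hence, for [0 < h],
    [P_h(G) = P_h(K) + P_h(S) + sum_(1 <= k < h) g(k) f(h - k)], and the cases
    of the theorem only record which terms vanish: [P_h(K)] and [g(h)] for
    [n1 <= h], [f(h)] for [t1 < h], [P_h(S)] for [t1 + t2 < h].  Paths are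
    counted through their listings, a path of positive length having exactly
    two, each the reverse of the other.  In [S] a path leaving the root extends
    to a leaf in exactly one way, which gives [f]. *)

Require Import Defs.
From mathcomp Require Import all_boot all_order all_algebra.
From mathcomp Require Import zify ring.

Set Implicit Arguments.
Unset Strict Implicit.
Unset Printing Implicit Defensive.

(** Undirectedness is the main obstacle: a path is a pair of sets, whereas cutting it at a vertex or
    extending it at an end is natural for lists. In a duplicate-free list of positive length the
    first vertex lies on a single listed edge, so the edge set determines the list up to reversal.
    Cuts at a vertex [x] always have the shape [rev a ++ x :: b], with both arms read outwards; an
    arm has a fixed direction, so counts of arms carry no factor 2. For [h = 2] the tree enters
    through its degrees: orienting every edge towards the root gives the degree sum, and the sum of
    [d * d.-1] is linear in it because degrees away from the root are 1 or 2. The vanishing of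
    [P_h(S)] past [t1 + t2] must also cover paths that miss the root; their vertices are at most as
    many as the edges of a longest branch. *)

Lemma leq_card_rel (A B : finType) (R : A -> B -> Prop)
    (X : {set A}) (Y : {set B}) :
  (forall a, a \in X -> exists2 b, b \in Y & R a b) ->
  (forall a1 a2 b, a1 \in X -> a2 \in X -> R a1 b -> R a2 b -> a1 = a2) ->
  #|X| <= #|Y|.
Proof.
move=> Rtot Rinj; have [->|[a0 a0X]] := set_0Vmem X; first by rewrite cards0.
have [b0 _ _] := Rtot a0 a0X.
have [|f fP] := @fin_all_exists A (fun=> B)
  (fun a b => a \in X -> b \in Y /\ R a b).
  move=> a; case: (boolP (a \in X)) => [aX|]; last by exists b0.
  by have [b bY Rab] := Rtot a aX; exists b.
rewrite -(card_in_imset (f := f)) => [|a1 a2 a1X a2X Ef].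
  apply/subset_leq_card/subsetP => b /imsetP[a aX ->].
  by case: (fP a aX).
apply: (Rinj a1 a2 (f a1)) => //; first by case: (fP a1 a1X).
by rewrite Ef; case: (fP a2 a2X).
Qed.

(** Stating bijections as relations spares writing inverse functions between tuple types whose
    lengths agree only up to a provable equation. *)
Lemma eq_card_rel (A B : finType) (R : A -> B -> Prop)
    (X : {set A}) (Y : {set B}) :
  (forall a, a \in X -> exists2 b, b \in Y & R a b) ->
  (forall b, b \in Y -> exists2 a, a \in X & R a b) ->
  (forall a1 a2 b, a1 \in X -> a2 \in X -> R a1 b -> R a2 b -> a1 = a2) ->
  (forall a b1 b2, b1 \in Y -> b2 \in Y -> R a b1 -> R a b2 -> b1 = b2) ->
  #|X| = #|Y|.
Proof.
move=> RX RY injX injY; apply/eqP; rewrite eqn_leq.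
rewrite (leq_card_rel RX injX) (leq_card_rel (R := fun b a => R a b)) //.
by move=> b1 b2 a Yb1 Yb2; exact: injY.
Qed.

(** * Vertex listings and the undirected paths they describe *)

Lemma sorted_rev_cat (T : Type) (e : rel T) (x : T) (a b : seq T) :
  symmetric e -> sorted e (rev a ++ x :: b) = path e x a && path e x b.
Proof.
move=> e_sym; elim: a x b => //= y a IH x b.
by rewrite rev_cons cat_rcons IH /= (e_sym y x); case: (e x y); rewrite ?andbF.
Qed.

Section Listings.
Variable G : sgraph.
Implicit Types (x y : G) (s p a b : seq G).

Definition list_edges s : {set {set G}} := (listed_subgraph s).2.

(** Cuts a path at [x]: each arm is again a listing from [x], and only disjointness links the
    two. *)
Lemma lists_path_rev_cat x a b :
  lists_path (rev a ++ x :: b) =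
  [&& lists_path (x :: a), lists_path (x :: b) & ~~ has (mem a) b].
Proof.
rewrite /lists_path (sorted_rev_cat _ _ _ (@adj_sym G)) cat_uniq rev_uniq /=.
rewrite mem_rev (eq_has (mem_rev a)).
by case: (x \in a); case: (x \in b); case: (has _ b); case: (uniq a);
  case: (uniq b); case: (path _ x a); case: (path _ x b).
Qed.

Lemma lists_path_rev s : lists_path (rev s) = lists_path s.
Proof.
rewrite /lists_path rev_uniq rev_sorted; congr (_ && _).
by apply: eq_sorted => x y; rewrite adj_sym.
Qed.

Lemma list_edges1 x : list_edges [:: x] = set0.
Proof. by apply/setP => e; rewrite inE; apply/negP => /imsetP[]. Qed.

Lemma list_edges_cons x y s :
  list_edges (x :: y :: s) = [set x; y] |: list_edges (y :: s).
Proof.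
apply/setP => e; rewrite !inE; apply/imsetP/orP => /=.
  case=> q; rewrite inE => /predU1P[-> ->|qs ->]; [by left | right].
  by apply/imsetP; exists q.
case=> [/eqP->|/imsetP[q qs ->]]; first by exists (x, y); rewrite ?inE ?eqxx.
by exists q => //; rewrite inE qs orbT.
Qed.

Lemma list_edges_cat a x b :
  list_edges (a ++ x :: b) = list_edges (rcons a x) :|: list_edges (x :: b).
Proof.
elim: a => [|y a IH] /=; first by rewrite list_edges1 set0U.
case: a IH => [|z a] /= IH; first by rewrite !list_edges_cons list_edges1 setU0.
by rewrite !list_edges_cons IH setUA.
Qed.

Lemma list_edges_rev s : list_edges (rev s) = list_edges s.
Proof.
elim: s => //= x [|y s] IH //.
rewrite list_edges_cons -IH !rev_cons -cats1 cat_rcons list_edges_cat setUC.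
by rewrite list_edges_cons list_edges1 setU0 [[set y; x]]setUC.
Qed.

Lemma mem_list_edges x e s : e \in list_edges s -> x \in e -> x \in s.
Proof.
elim: s => [|y [|z s] IH] /=; first by case/imsetP.
  by rewrite list_edges1 inE.
rewrite list_edges_cons in_setU in_set1 => /orP[/eqP->|es xe].
  by rewrite !inE => /orP[]->; rewrite ?orbT.
by rewrite in_cons IH ?orbT.
Qed.

Lemma set2_inj x y z : [set x; y] = [set x; z] -> y = z.
Proof.
move=> E; have : z \in [set x; y] by rewrite E !inE eqxx orbT.
have : y \in [set x; z] by rewrite -E !inE eqxx orbT.
by rewrite !inE => /orP[/eqP->|/eqP->] //; rewrite orbb => /eqP.
Qed.

(** As [x] does not recur, [[set x; y]] is the one edge at [x]; it reveals the second vertex, and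
    erasing it leaves the tails to the induction. *)
Lemma list_edges_inj x s1 s2 : uniq (x :: s1) -> uniq (x :: s2) ->
  list_edges (x :: s1) = list_edges (x :: s2) -> s1 = s2.
Proof.
elim: s1 s2 x => [|y s1 IH] [|z s2] x //.
- move=> _ _; rewrite list_edges1 list_edges_cons => /setP/(_ [set x; z]).
  by rewrite !inE eqxx.
- move=> _ _; rewrite list_edges1 list_edges_cons => /setP/(_ [set x; y]).
  by rewrite !inE eqxx.
rewrite !list_edges_cons ![uniq (x :: _)]/= => /andP[xs1 us1] /andP[xs2 us2] E.
have eyz : y = z.
  have: [set x; y] \in [set x; z] |: list_edges (z :: s2).
    by rewrite -E !inE eqxx.
  rewrite !inE => /orP[/eqP/set2_inj //|/mem_list_edges/(_ _)/= xs].
  by rewrite xs // !inE eqxx in xs2.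
rewrite -eyz in E us2 xs2 *; congr (_ :: _); apply: IH us1 us2 _.
have ninE s : x \notin s -> [set x; y] \notin list_edges s.
  by apply: contra => /mem_list_edges; apply; rewrite !inE eqxx.
by rewrite -(setU1K (ninE _ xs1)) E (setU1K (ninE _ xs2)).
Qed.

(** The head of a path lies on one edge, whereas an inner vertex of [s] would lie on two, with
    distinct other ends. *)
Lemma list_edges_end x p s : uniq (x :: p) -> uniq s -> p != [::] ->
  list_edges (x :: p) = list_edges s ->
  (exists q, s = x :: q) \/ (exists q, s = rcons q x).
Proof.
case: p => // y0 p uxp us _ E.
have xs : x \in s.
  apply: (mem_list_edges (e := [set x; y0])); last by rewrite !inE eqxx.
  by rewrite -E list_edges_cons !inE eqxx.
case/splitPr: xs E us => a b E us.
case: (lastP a) E us => [|{}a w]; first by left; exists b.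
case: b => [|z b]; first by right; exists (rcons a w); rewrite cats1.
rewrite cat_rcons => E us.
(* Both neighbours [w] and [z] of [x] in [s] would have to be [y0]. *)
have edge v : [set x; v] \in list_edges (x :: y0 :: p) -> v = y0.
  rewrite list_edges_cons !inE => /orP[/eqP/set2_inj //|].
  move/mem_list_edges=> /(_ x); rewrite !inE eqxx => /(_ isT).
  by move: uxp; rewrite /= !inE => /andP[/negPf->].
have ew : w = y0.
  apply: edge; rewrite E list_edges_cat list_edges_cons !inE setUC eqxx.
  by rewrite orbT.
have ez : z = y0.
  by apply: edge; rewrite E list_edges_cat !list_edges_cons !inE eqxx !orbT.
by move: us; rewrite ew ez cat_uniq /= !inE eqxx orbT /= !andbF.
Qed.

Lemma card_list_edges x s : uniq (x :: s) -> #|list_edges (x :: s)| = size s.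
Proof.
elim: s x => [|y s IH] x; first by rewrite list_edges1 cards0.
rewrite list_edges_cons cardsU1 => /andP[xs us]; rewrite IH //.
suff ->: [set x; y] \notin list_edges (y :: s) by [].
by apply: contra xs => /mem_list_edges; apply; rewrite !inE eqxx.
Qed.

(** The head of [s1] is the first or last entry of [s2], and reversing [s2] reduces the second case
    to the first. A one-vertex list has no edge to compare, hence the size bound. *)
Lemma listed_subgraph_eq s1 s2 : uniq s1 -> uniq s2 -> 1 < size s1 ->
  (listed_subgraph s1 == listed_subgraph s2) = (s1 == s2) || (s1 == rev s2).
Proof.
move=> u1 u2 s1_gt1; apply/eqP/orP=> [/(congr1 snd) E|].
  case: s1 u1 E s1_gt1 => // x p u1 E p_gt0.
  have pN : p != [::] by case: (p) p_gt0.
  have [[q e2]|[q e2]] := list_edges_end u1 u2 pN E.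
    by left; rewrite e2 in E u2 *; rewrite (list_edges_inj u1 u2 E).
  right; apply/eqP; move: E u2; rewrite -[(listed_subgraph s2).2]list_edges_rev.
  rewrite -(rev_uniq s2) e2 rev_rcons => E u2.
  by rewrite (list_edges_inj u1 u2 E).
case=> /eqP-> //; congr pair; last exact: list_edges_rev.
by apply/setP => x; rewrite !inE mem_rev.
Qed.

Definition listings h : {set h.+1.-tuple G} := [set t : h.+1.-tuple G | lists_path t].

Definition listings_from x h : {set h.+1.-tuple G} :=
  [set t : h.+1.-tuple G | lists_path t && (thead t == x)].

Lemma listings_fromP x h (t : h.+1.-tuple G) :
  reflect (exists2 p, tval t = x :: p & lists_path (x :: p))
          (t \in listings_from x h).
Proof.
rewrite inE; apply: (iffP andP) => [[lt /eqP<-]|[p Et lp]].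
  by exists (behead t); move: lt; rewrite {1 2}(tuple_eta t).
by split; [rewrite Et | rewrite /thead (tnth_nth x) Et].
Qed.

Lemma card_listings h : 0 < h -> #|listings h| = (num_paths G h).*2.
Proof.
move=> h_gt0; rewrite /num_paths.
have -> : paths G h = (fun t : h.+1.-tuple G => listed_subgraph t) @: listings h.
  by apply: eq_imset.
rewrite -sum1_card (partition_big_imset (fun t : h.+1.-tuple G => listed_subgraph t)) /=.
rewrite -muln2 -sum_nat_const; apply: eq_bigr => P /imsetP[t]; rewrite inE.
move=> lt ->; have [ut _] := andP lt.
(* Each fibre of [listed_subgraph] is compared with this pair; its members differ because a path of
   positive length has distinct ends. *)
have -> : 2 = #|[set t; rev_tuple t]|.
  rewrite cards2; case: eqP => // /(congr1 val) /=.
  move: (size_tuple t) ut => {lt}; case: (tval t) => [|x p] //.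
  case/lastP: p => [|p z]; first by case: (h) h_gt0.
  rewrite rev_cons rev_rcons /= mem_rcons inE => _ /andP[/norP[/eqP xz _] _].
  by case.
rewrite -sum1_card; apply: eq_bigl => t1; rewrite !inE -!val_eqE /=.
apply/andP/idP => [[lt1]|].
  by rewrite listed_subgraph_eq ?size_tuple //; case/andP: lt1.
by case/orP=> /eqP->; rewrite ?lists_path_rev listed_subgraph_eq ?lt ?rev_uniq
  ?size_rev ?size_tuple // eqxx ?orbT.
Qed.

(** The prescribed start fixes the direction, so no factor 2 appears, unlike in [card_listings]. *)
Lemma card_paths_from x h : 0 < h -> #|paths_from x h| = #|listings_from x h|.
Proof.
move=> h_gt0; rewrite /paths_from.
have -> : [set listed_subgraph t | t : h.+1.-tuple G
            & lists_path t && (thead t == x)]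
    = (fun t : h.+1.-tuple G => listed_subgraph t) @: listings_from x h.
  by apply: eq_imset.
rewrite card_in_imset // => t1 t2 /listings_fromP[p1 E1 /andP[u1 _]].
case/listings_fromP=> p2 E2 /andP[u2 _] E; apply: val_inj; rewrite /= E1 E2.
congr (_ :: _); apply: list_edges_inj u1 u2 _.
by rewrite -E1 -E2 /list_edges E.
Qed.

Lemma num_paths0 : num_paths G 0 = #|G|.
Proof.
rewrite /num_paths -[RHS](card_imset predT (f := fun x => listed_subgraph [:: x])).
  apply: eq_card => P; apply/imsetP/imsetP => [[t _ ->]|[x _ ->]].
    exists (thead t) => //; congr listed_subgraph.
    by case/tupleP: t => x t; rewrite (tuple0 t).
  by exists [tuple x]; rewrite ?inE.
move=> x y /(congr1 fst)/setP/(_ x); rewrite !inE eqxx.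
by move/esym/eqP.
Qed.

Lemma num_paths_ge_card h : #|G| <= h -> num_paths G h = 0.
Proof.
move=> leGh; apply/eqP; rewrite /num_paths cards_eq0.
apply/eqP/setP => P; rewrite inE; apply/negP => /imsetP[t].
rewrite inE => /andP[/card_uniqP Et _] _.
by have := max_card (mem t); rewrite Et size_tuple ltnNge leGh.
Qed.

Lemma lists_path_cons x p : lists_path (x :: p) ->
  [/\ x \notin p, uniq p & path (@adj G) x p].
Proof. by case/andP=> /andP[]. Qed.

Lemma card_listings1 : #|listings 1| = \sum_(x : G) degree x.
Proof.
rewrite (eq_bigr (fun x => \sum_(y | adj x y) 1)) => [|x _].
  rewrite pair_big_dep /= sum1_card -cardsE.
  apply: (eq_card_rel (R := fun t q => tval t = [:: q.1; q.2])).
  - move=> [[|x [|y [|]]] // st]; rewrite !inE /lists_path /= => /andP[_].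
    by rewrite andbT => xy; exists (x, y); rewrite ?inE.
  - move=> [x y]; rewrite inE => /= xy; exists [tuple x; y] => //.
    have {}xy : adj x y := xy; rewrite !inE /lists_path /= xy !inE !andbT.
    by apply: contraTneq xy => ->; rewrite adj_irr.
  - by move=> t1 t2 q _ _ E1 E2; apply: val_inj; rewrite /= E1 E2.
  - by move=> t [x1 y1] [x2 y2] _ _ /= -> [-> ->].
by rewrite /degree sum1dep_card.
Qed.

(** Grouping by the middle vertex leaves an ordered pair of distinct neighbours of it. *)
Lemma card_listings2 : #|listings 2| = \sum_(x : G) degree x * (degree x).-1.
Proof.
rewrite -sum1_card (partition_big (fun t : 3.-tuple G => tnth t 1%R) predT) //=.
apply: eq_bigr => x _; rewrite sum1dep_card.
have -> d : d * d.-1 = d ^_ 2 by rewrite ffactnS ffactn1.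
rewrite /degree -(card_uniq_tuples 2 (mem [set y | adj x y])) -[RHS]cardsE.
apply: (eq_card_rel (R := fun (t : 3.-tuple G) (q : 2.-tuple G) =>
   exists y z, tval t = [:: y; x; z] /\ tval q = [:: y; z])).
- move=> [[|y [|x1 [|z [|]]]] // st].
  rewrite !inE /lists_path (tnth_nth x) /= !inE !andbT.
  case/andP=> /andP[/andP[/norP[_ yz] _] /andP[yx xz]] /eqP Ex.
  exists [tuple y; z]; last by exists y, z; rewrite Ex.
  by rewrite !inE /= !inE -Ex xz adj_sym yx yz.
- move=> [[|y [|z [|]]] // sq]; rewrite !inE /= !inE !andbT.
  case/andP=> /andP[xy xz] yz; exists [tuple y; x; z]; last by exists y, z.
  rewrite !inE /lists_path (tnth_nth x) /= !inE eqxx !andbT adj_sym xy xz negb_or yz.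
  rewrite !andbT; apply/andP; split.
    by apply: contraTneq xy => ->; rewrite adj_irr.
  by apply: contraTneq xz => ->; rewrite adj_irr.
- move=> t1 t2 q _ _ [y1 [z1 [E1 F1]]] [y2 [z2 [E2 F2]]]; apply: val_inj => /=.
  by move: F1; rewrite E1 E2 F2 => -[-> ->].
- move=> t q1 q2 _ _ [y1 [z1 [E1 F1]]] [y2 [z2 [E2 F2]]]; apply: val_inj => /=.
  by move: E1; rewrite F1 F2 E2 => -[-> ->].
Qed.

Lemma card_listings_from1 x : #|listings_from x 1| = degree x.
Proof.
apply: (eq_card_rel (R := fun (t : 2.-tuple G) y => tval t = [:: x; y])).
- move=> t /listings_fromP[p Et /lists_path_cons[_ _]].
  have := size_tuple t; rewrite Et; case: p Et => [|y []] // Et _ /andP[xy _].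
  by exists y; rewrite ?inE.
- move=> y; rewrite inE => xy; exists [tuple x; y] => //.
  apply/listings_fromP; exists [:: y] => //; rewrite /lists_path /= xy inE !andbT.
  by apply: contraTneq xy => ->; rewrite adj_irr.
- by move=> t1 t2 y _ _ E1 E2; apply: val_inj; rewrite /= E1 E2.
- by move=> t y1 y2 _ _ -> [].
Qed.

End Listings.

(** * Coalescences *)

Lemma lists_path_map (G H : sgraph) (f : G -> H) s :
  injective f -> {mono f : x y / adj x y} ->
  lists_path (map f s) = lists_path s.
Proof.
move=> f_inj f_adj; rewrite /lists_path map_inj_uniq // sorted_map.
by congr (_ && _); apply: eq_sorted => x y; exact: f_adj.
Qed.

Lemma last_rev (T : Type) (x : T) s : last x (rev s) = head x s.
Proof. by case: s => //= y s; rewrite rev_cons last_rcons. Qed.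

Lemma head_rev (T : Type) (x : T) s : head x (rev s) = last x s.
Proof. by rewrite -[s in RHS]revK last_rev. Qed.

Section CoalescencePaths.
Variables (G H : sgraph) (u : G) (v : H).
Local Notation C := (coalescence u v).
Local Notation x0 := (inl u : C).
Implicit Types (z : C) (s a b : seq C).

Definition is_inr z : bool := if z is inr _ then true else false.

Definition from_left (x : G) : C := inl x.
(** Here and in [to_right], the other graph is collapsed onto the merged vertex; the maps are used
    on [on_left] and [on_right] respectively. *)
Definition to_left z : G := if z is inl x then x else u.
Definition from_right (y : H) : C := if insub y is Some y' then inr y' else x0.
Definition to_right z : H := if z is inr y then val y else v.
Definition on_left z : bool := ~~ is_inr z.
(** The merged vertex is an [inl], so the right side has to include it explicitly; it belongs to
    both sides. *)
Definition on_right z : bool := is_inr z || (z == x0).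

Lemma from_right_v : from_right v = x0.
Proof. by rewrite /from_right insubN // eqxx. Qed.

Lemma from_right_val (y : {y : H | y != v}) : from_right (val y) = inr y.
Proof. by rewrite /from_right valK. Qed.

Lemma from_rightP y :
  (y = v /\ from_right y = x0)
  \/ (y != v /\ exists2 y', y = val y' & from_right y = inr y').
Proof.
case: (eqVneq y v) => [->|yv]; first by left; rewrite from_right_v.
by right; split=> //; exists (Sub y yv) => //; rewrite -from_right_val.
Qed.

Lemma to_leftK : {in on_left, cancel to_left from_left}.
Proof. by case. Qed.

Lemma from_leftK : cancel from_left to_left.
Proof. by []. Qed.

Lemma from_rightK : cancel from_right to_right.
Proof.
by move=> y; case: (from_rightP y) => [[-> ->]|[_ [y' -> ->]]].
Qed.

Lemma to_rightK : {in on_right, cancel to_right from_right}.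
Proof.
by case=> [x /eqP[->]|y _] /=; rewrite ?from_right_v ?from_right_val.
Qed.

Lemma on_right_from y : on_right (from_right y).
Proof.
by case: (from_rightP y) => [[_ ->]|[_ [y' _ ->]]]; rewrite /on_right ?eqxx.
Qed.

Lemma adj_from_left : {mono from_left : x y / adj x y}.
Proof. by []. Qed.

Lemma adj_from_right : {mono from_right : x y / adj x y}.
Proof.
move=> x y; case: (from_rightP x) => [[-> ->]|[_ [x' -> ->]]];
  case: (from_rightP y) => [[-> ->]|[_ [y' -> ->]]] //=;
  by rewrite ?adj_irr ?eqxx.
Qed.

Lemma map_from_to_left s : all on_left s -> map from_left (map to_left s) = s.
Proof.
move/allP=> sl; rewrite -map_comp map_id_in // => z zs /=.
by rewrite to_leftK //; exact: sl.
Qed.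

Lemma map_from_to_right s : all on_right s -> map from_right (map to_right s) = s.
Proof.
move/allP=> sl; rewrite -map_comp map_id_in // => z zs /=.
by rewrite to_rightK //; exact: sl.
Qed.

Lemma all_on_left_map (s : seq G) : all on_left (map from_left s).
Proof. by elim: s. Qed.

Lemma all_on_right_map (s : seq H) : all on_right (map from_right s).
Proof. by elim: s => //= y s ->; rewrite on_right_from. Qed.

Lemma adj_side (z w : C) : z != x0 -> w != x0 -> adj z w -> is_inr z = is_inr w.
Proof.
case: z w => [x|x] [y|y] //= xN yN /andP[/eqP E _].
  by rewrite E eqxx in xN.
by rewrite E eqxx in yN.
Qed.

Lemma path_side z s : x0 \notin z :: s -> path (@adj C) z s ->
  all (fun w => is_inr w == is_inr z) s.
Proof.
elim: s z => //= w s IH z x0N /andP[zw ws].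
have E : is_inr z = is_inr w.
  by apply: adj_side zw; apply: contraNneq x0N => ->; rewrite !inE eqxx ?orbT.
rewrite E eqxx /= IH //; apply: contra x0N => ?; exact: mem_behead.
Qed.

Lemma all_side_left s : all (fun w => is_inr w == false) s -> all on_left s.
Proof. by apply: sub_all => w /eqP; rewrite /on_left => ->. Qed.

Lemma all_side_right s : all (fun w => is_inr w == true) s -> all on_right s.
Proof. by apply: sub_all => w /eqP; rewrite /on_right => ->. Qed.

(** The direction is fixed, from the first graph to the second, so a crossing path is caught by
    exactly one of [s] and [rev s]. The test [~~ on_right] excludes [x0]: a path that starts at the
    merged vertex does not cross. *)
Definition crosses s := ~~ on_right (head x0 s) && is_inr (last x0 s).

Lemma lists_path_pivot a b : lists_path (a ++ x0 :: b) ->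
  [/\ lists_path (x0 :: rev a), lists_path (x0 :: b),
      exists i, all (fun w => is_inr w == i) a
    & exists i, all (fun w => is_inr w == i) b].
Proof.
rewrite -{1}(revK a) lists_path_rev_cat => /and3P[la lb _].
have side c : lists_path (x0 :: c) -> exists i, all (fun w => is_inr w == i) c.
  case: c => [|z c]; first by exists true.
  move=> /lists_path_cons[x0c _ /andP[_ /(path_side x0c) cz]].
  by exists (is_inr z); rewrite /= eqxx.
by split=> //; [case: (side _ la) => i; rewrite all_rev; exists i | exact: side].
Qed.

(** Removing [x0] leaves at most two arms, each within one summand. Arms in the same summand give a
    one-sided path; arms in different ones give a crossing, unless one of them is empty. *)
Lemma lists_path_sides s : lists_path s ->
  [|| all on_left s, all on_right s, crosses s | crosses (rev s)].
Proof.
move=> ls; have [us ss] := andP ls.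
case: (boolP (x0 \in s)) => [x0s|x0N]; last first.
  case: s {us ls} x0N ss => //= z s x0N /(path_side x0N).
  case E: (is_inr z) => Hs.
  - by rewrite /= all_side_right // (_ : on_right z) ?orbT // /on_right E.
  - by rewrite /= all_side_left // (_ : on_left z) // /on_left E.
case/splitPr: x0s us ls {ss} => a b us /lists_path_pivot[_ _ [i aI] [j bJ]].
have x0l : on_left x0 by [].
have x0r : on_right x0 by rewrite /on_right eqxx orbT.
have x0a : x0 \notin a.
  by move: us; rewrite cat_uniq => /and3P[_ /= /norP[? _] _].
have x0b : x0 \notin b.
  by move: us; rewrite cat_uniq => /and3P[_ _ /andP[]].
rewrite !all_cat /= ?x0l ?x0r ?eqxx /=.
have oL c : all (fun w => is_inr w == false) c -> all on_left c := @all_side_left c.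
have oR c : all (fun w => is_inr w == true) c -> all on_right c := @all_side_right c.
case: i aI => aI; case: j bJ => bJ.
- by rewrite (oR _ aI) (oR _ bJ) orbT.
- case: a aI x0a {us} => [|z a] aI x0a; first by rewrite /= (oL _ bJ).
  case/lastP: b bJ x0b => [|b w] bJ x0b; first by rewrite (oR _ aI) orbT.
  move: x0b bJ; rewrite all_rcons mem_rcons inE => /norP[x0w _] /andP[/eqP wL _].
  apply/or4P/Or44; rewrite /crosses head_rev last_rev last_cat /= last_rcons.
  by rewrite /on_right wL eq_sym x0w; case/andP: aI => /eqP->.
- case/lastP: b bJ {x0b us} => [|b w] bJ; first by rewrite (oL _ aI).
  case: a aI x0a => [|z a] aI x0a; first by rewrite /= (oR _ bJ) orbT.
  move: x0a aI; rewrite inE /= => /norP[x0z _] /andP[/eqP zL _].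
  apply/or4P/Or43; rewrite /crosses /= last_cat /= last_rcons /on_right zL.
  by rewrite eq_sym x0z; move: bJ; rewrite all_rcons => /andP[/eqP->].
- by rewrite (oL _ aI) (oL _ bJ).
Qed.

(** A path missing [x0] would stay in one summand, against the position of its ends; so it can be
    cut at [x0]. *)
Lemma crossesP s : lists_path s -> crosses s ->
  exists (a : seq G) (b : seq H), [/\ s = rev (map from_left a) ++ map from_right (v :: b),
    a != [::], b != [::], lists_path (u :: a) & lists_path (v :: b)].
Proof.
move=> ls /andP[hL lR]; case: (boolP (x0 \in s)) => [x0s|x0N]; last first.
  case: s ls x0N hL lR => [|z s] ls x0N; first by rewrite /= /on_right eqxx.
  rewrite /= => /norP[/negPf zL _].
  have [_ _ /(path_side x0N)/allP sz] := lists_path_cons ls.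
  case/lastP: s sz {ls x0N} => [|s w] sz; first by rewrite /= zL.
  have /sz/eqP wz : w \in rcons s w by rewrite mem_rcons inE eqxx.
  by rewrite last_rcons wz zL.
case/splitPr: x0s ls hL lR => a b /lists_path_pivot[la lb [i aI] [j bJ]].
rewrite last_cat /=.
case: a la aI => [|z a] la aI; first by rewrite /= /on_right eqxx.
rewrite /= => /norP[zL _].
case/lastP: b lb bJ => [|b w] lb bJ //; rewrite last_rcons => wR.
have aL : all on_left (z :: a).
  apply: all_side_left; case/andP: (aI) => /eqP Ei _.
  by move: aI zL; rewrite Ei; case: (i).
have bR : all on_right (rcons b w).
  apply: all_side_right; move: (bJ); rewrite all_rcons => /andP[/eqP Ej _].
  by move: bJ wR; rewrite Ej; case: (j).
exists (map to_left (rev (z :: a))), (map to_right (rcons b w)).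
rewrite map_from_to_left ?all_rev // revK /= map_from_to_right // from_right_v.
split=> //.
- by rewrite rev_cons map_rcons; case: (map _ _).
- by rewrite map_rcons; case: (map _ _).
- move: la; rewrite -[x0 :: _](map_from_to_left (s := x0 :: _)).
    by rewrite (lists_path_map _ (can_inj from_leftK) adj_from_left).
  by rewrite /= all_rev.
- move: lb; rewrite -[x0 :: _](map_from_to_right (s := x0 :: _)).
    by rewrite (lists_path_map _ (can_inj from_rightK) adj_from_right).
  by rewrite /= /on_right eqxx orbT.
Qed.

Lemma crosses_not_left s : all on_left s -> crosses s = false.
Proof.
rewrite /crosses; case/lastP: s => [|s z]; first by rewrite /= andbF.
by rewrite all_rcons last_rcons => /andP[/negPf-> _]; rewrite andbF.
Qed.

Lemma crosses_not_right s : all on_right s -> crosses s = false.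
Proof.
by rewrite /crosses; case: s => [|z s] /=; rewrite ?andbF // => /andP[->].
Qed.

(** A sum of booleans, so that summing over all listings yields the four counts at once. Two
    vertices are required because [[:: x0]] lies on both sides. *)
Lemma sides_exclusive s : lists_path s -> 1 < size s ->
  all on_left s + all on_right s + crosses s + crosses (rev s) = 1.
Proof.
move=> ls s_gt1; have := lists_path_sides ls.
case Ls: (all on_left s); case Rs: (all on_right s).
- case: s ls s_gt1 Ls Rs => [|z [|w s]] //= ls _ /and3P[zl wl _] /and3P[zr wr _].
  have E y : on_left y -> on_right y -> y = x0.
    by rewrite /on_left /on_right => /negPf-> /eqP.
  by case/andP: ls; rewrite /= (E z) // (E w) // inE eqxx.
- by rewrite !crosses_not_left ?all_rev.
- by rewrite !crosses_not_right ?all_rev.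
- case Cs: (crosses s); case Cr: (crosses (rev s)) => //=.
  move: Cs Cr; rewrite /crosses head_rev => /andP[_ zr] /andP[].
  by rewrite /on_right zr.
Qed.

Lemma card_listings_left h :
  #|[set t in listings C h | all on_left t]| = #|listings G h|.
Proof.
apply: (eq_card_rel (R := fun (t : h.+1.-tuple C) (q : h.+1.-tuple G) =>
  tval t = map from_left q)).
- move=> t; rewrite !inE => /andP[lt Lt]; exists [tuple of map to_left t].
    by rewrite inE -(lists_path_map _ (can_inj from_leftK) adj_from_left)
      map_from_to_left.
  by rewrite /= map_from_to_left.
- move=> q; rewrite inE => lq; exists [tuple of map from_left q] => //.
  rewrite !inE /= (lists_path_map _ (can_inj from_leftK) adj_from_left) lq.
  exact: all_on_left_map.
- by move=> t1 t2 q _ _ E1 E2; apply: val_inj; rewrite /= E1 E2.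
- move=> t q1 q2 _ _ -> E; apply: val_inj.
  exact: (inj_map (can_inj from_leftK) E).
Qed.

Lemma card_listings_right h :
  #|[set t in listings C h | all on_right t]| = #|listings H h|.
Proof.
apply: (eq_card_rel (R := fun (t : h.+1.-tuple C) (q : h.+1.-tuple H) =>
  tval t = map from_right q)).
- move=> t; rewrite !inE => /andP[lt Lt]; exists [tuple of map to_right t].
    by rewrite inE -(lists_path_map _ (can_inj from_rightK) adj_from_right)
      map_from_to_right.
  by rewrite /= map_from_to_right.
- move=> q; rewrite inE => lq; exists [tuple of map from_right q] => //.
  rewrite !inE /= (lists_path_map _ (can_inj from_rightK) adj_from_right) lq.
  exact: all_on_right_map.
- by move=> t1 t2 q _ _ E1 E2; apply: val_inj; rewrite /= E1 E2.
- move=> t q1 q2 _ _ -> E; apply: val_inj.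
  exact: (inj_map (can_inj from_rightK) E).
Qed.

Lemma card_crosses_rev h :
  #|[set t in listings C h | crosses (rev t)]|
  = #|[set t in listings C h | crosses t]|.
Proof.
apply: (eq_card_rel (R := fun (t q : h.+1.-tuple C) => tval t = rev q)).
- move=> t; rewrite !inE => /andP[lt ct]; exists (rev_tuple t).
    by rewrite !inE /= lists_path_rev lt.
  by rewrite /= revK.
- move=> q; rewrite !inE => /andP[lq cq]; exists (rev_tuple q) => //.
  by rewrite !inE /= lists_path_rev lq revK.
- by move=> t1 t2 q _ _ E1 E2; apply: val_inj; rewrite /= E1 E2.
- by move=> t q1 q2 _ _ -> E; apply: val_inj; exact: (can_inj revK E).
Qed.

(** The position of [x0] recovers the length of the first arm, by which crossing listings get
    sorted. *)
Lemma index_cross (a : seq G) (b : seq H) : u \notin a ->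
  index x0 (rev (map from_left a) ++ map from_right (v :: b)) = size a.
Proof.
move=> ua; rewrite /= from_right_v index_pivot ?size_rev ?size_map //.
by rewrite mem_rev (mem_map (can_inj from_leftK)).
Qed.

Lemma cross_lists_path (a : seq G) (b : seq H) :
  lists_path (u :: a) -> lists_path (v :: b) ->
  lists_path (rev (map from_left a) ++ map from_right (v :: b)).
Proof.
move=> la lb; rewrite /= from_right_v lists_path_rev_cat.
apply/and3P; split.
- rewrite -[x0 :: _]/(map from_left (u :: a)).
  by rewrite (lists_path_map _ (can_inj from_leftK) adj_from_left).
- rewrite -from_right_v -map_cons.
  by rewrite (lists_path_map _ (can_inj from_rightK) adj_from_right).
apply/hasPn => z /mapP[y yb ->] /=; apply/negP => /mapP[x _].
have [[yv _]|[_ [y' _ ->]] //] := from_rightP y.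
by have [/negP[]] := lists_path_cons lb; rewrite -yv.
Qed.

Lemma card_crosses_at h k : 0 < k < h ->
  #|[set t in listings C h | crosses t && (index x0 t == k)]|
  = #|listings_from u k| * #|listings_from v (h - k)|.
Proof.
case/andP=> k_gt0 kh; rewrite -cardsX.
(* [behead] drops [u], since the merged vertex already appears as the image of [v]. *)
apply: (eq_card_rel (R := fun (t : h.+1.-tuple C)
    (q : k.+1.-tuple G * (h - k).+1.-tuple H) =>
  tval t = rev (map from_left (behead q.1)) ++ map from_right q.2)).
- move=> t; rewrite !inE => /and3P[lt ct /eqP it].
  have [a [b [Et _ _ la lb]]] := crossesP lt ct.
  have sa : size a = k.
    by move: it; rewrite Et index_cross //; case/lists_path_cons: la.
  have sb : size b = h - k.
    have := size_tuple t; rewrite Et size_cat size_rev /= !size_map sa; lia.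
  have sa1 : size (u :: a) == k.+1 by rewrite /= sa.
  have sb1 : size (v :: b) == (h - k).+1 by rewrite /= sb.
  exists (Tuple sa1, Tuple sb1); last by [].
  rewrite in_setX; apply/andP; split; apply/listings_fromP.
    by exists a.
  by exists b.
- move=> [q1 q2]; rewrite in_setX => /andP[/listings_fromP[a /= E1 la]].
  case/listings_fromP=> b /= E2 lb.
  have sa : size a = k by have := size_tuple q1; rewrite E1 => -[].
  have sb : size b = h - k by have := size_tuple q2; rewrite E2 => -[].
  have st : size (rev (map from_left a) ++ map from_right (v :: b)) == h.+1.
    by rewrite size_cat size_rev !size_map /= sa sb; apply/eqP; lia.
  exists (Tuple st); last by rewrite /= E1 E2.
  rewrite !inE cross_lists_path // index_cross ?sa ?eqxx ?andbT /=; last first.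
    by case/lists_path_cons: la.
  rewrite /crosses last_cat.
  case/lastP: a sa {E1 st} la => [|a x] sa la; first by move: k_gt0; rewrite -sa.
  case/lastP: b sb {E2} lb => [|b y] sb lb.
    by move: kh; rewrite -subn_gt0 -sb.
  rewrite map_rcons rev_rcons /= map_rcons last_rcons.
  have xu : x != u.
    case/lists_path_cons: la => + _ _.
    by rewrite mem_rcons inE negb_or eq_sym => /andP[].
  have yv : y != v.
    case/lists_path_cons: lb => + _ _.
    by rewrite mem_rcons inE negb_or eq_sym => /andP[].
  have [[E _]|[_ [y' _ ->]]] := from_rightP y; first by rewrite E eqxx in yv.
  by rewrite andbT; apply: contraNN xu => /eqP[->].
- by move=> t1 t2 q _ _ E1 E2; apply: val_inj; rewrite /= E1 E2.
- move=> t [p1 p2] [q1 q2]; rewrite !in_setX.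
  case/andP=> /listings_fromP[a /= Ep1 la] /listings_fromP[b /= Ep2 lb].
  case/andP=> /listings_fromP[c /= Eq1 lc] /listings_fromP[d /= Eq2 ld].
  rewrite Ep1 Ep2 Eq1 Eq2 => -> /= /eqP; rewrite eqseq_cat; last first.
    have := size_tuple p1; have := size_tuple q1; rewrite Ep1 Eq1 !size_rev.
    by rewrite !size_map => -[->] [->].
  case/andP=> /eqP/(can_inj revK)/(inj_map (can_inj from_leftK)) ac.
  case/eqP => /(inj_map (can_inj from_rightK)) bd.
  by congr pair; apply: val_inj; rewrite /= ?Ep1 ?Ep2 ?Eq1 ?Eq2 ?ac ?bd.
Qed.

Lemma card_crosses h :
  #|[set t in listings C h | crosses t]|
  = \sum_(1 <= k < h) #|listings_from u k| * #|listings_from v (h - k)|.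
Proof.
have idx (t : h.+1.-tuple C) : t \in [set t in listings C h | crosses t] ->
    0 < index x0 t < h.
  rewrite !inE => /andP[lt ct]; have [a [b [Et a0 b0 la _]]] := crossesP lt ct.
  have := size_tuple t; rewrite Et index_cross; last by case/lists_path_cons: la.
  rewrite size_cat size_rev /= !size_map.
  by case: (a) a0 => // x a1 _; case: (b) b0 => //= y b1 _; lia.
case: h idx => [|h] idx.
  rewrite big_nil; apply: eq_card0 => t; apply/negP => /idx; lia.
rewrite -sum1_card big_geq_mkord /=.
(* By [idx] the position of [x0] is below the bound, so [inord] loses nothing. *)
rewrite (partition_big (fun t : h.+2.-tuple C => inord (index x0 t) : 'I_h.+1)
  (fun i => 0 < i)) => [|t /idx/andP[? ?]]; last by rewrite inordK.
apply: eq_bigr => i i_gt0; rewrite -card_crosses_at ?i_gt0 ?ltn_ord //.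
rewrite sum1dep_card; apply: eq_card => t; rewrite [in RHS]inE andbA !inE.
case: (boolP (lists_path t && crosses t)) => //= lct.
have /idx/andP[? ti] : t \in [set t in listings C h.+1 | crosses t] by rewrite !inE.
by rewrite -val_eqE /= inordK.
Qed.

(** After doubling, every path count on a single graph is a listing count. Crossing listings come in
    two directions, which accounts for the doubled sum. *)
Lemma num_paths_coalescence h : 0 < h ->
  num_paths C h = num_paths G h + num_paths H h
    + \sum_(1 <= k < h) #|paths_from u k| * #|paths_from v (h - k)|.
Proof.
move=> h_gt0; apply: double_inj; rewrite !doubleD -!card_listings //.
have card_if (b : pred (h.+1.-tuple C)) :
    \sum_(t in listings C h) b t = #|[set t in listings C h | b t]|.
  by rewrite -sum1dep_card big_mkcondr; apply: eq_bigr => t _; case: (b t).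
rewrite -sum1_card (eq_bigr (fun t : h.+1.-tuple C => all on_left t
  + all on_right t + crosses t + crosses (rev t))) => [|t]; last first.
  by rewrite inE => lt; rewrite sides_exclusive ?size_tuple.
rewrite !big_split /= (card_if (fun t => all on_left t)).
rewrite (card_if (fun t => all on_right t)) (card_if (fun t => crosses t)).
rewrite (card_if (fun t => crosses (rev t))) card_crosses_rev.
rewrite card_listings_left card_listings_right -addnA addnn card_crosses.
congr (_ + _.*2); apply: eq_big_nat => k /andP[k_gt0 kh].
by rewrite !card_paths_from // subn_gt0.
Qed.

End CoalescencePaths.

(** * Complete graphs and trees *)

Section CompletePaths.
Variable n : nat.
Local Notation K := (complete_graph n).

Lemma complete_lists_path (s : seq K) : lists_path s = uniq s.
Proof.
rewrite /lists_path; case: s => //= x s; apply: andb_idr.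
elim: s x => //= y s IH x /and3P[xs ys us]; rewrite IH ?ys // andbT.
by move: xs; rewrite inE => /norP[].
Qed.

Lemma card_listings_complete h : #|listings K h| = n ^_ h.+1.
Proof.
rewrite -[in RHS](card_ord n) -(card_uniq_tuples h.+1 (mem predT)) -[RHS]cardsE.
apply: eq_card => t; rewrite !inE complete_lists_path.
by rewrite (_ : all _ t) //; apply/allP.
Qed.

Lemma card_paths_from_complete (u : K) k : 0 < k ->
  #|paths_from u k| = n.-1 ^_ k.
Proof.
move=> k_gt0; rewrite card_paths_from //.
have -> : n.-1 = #|predC1 u|.
  by have := cardC1 u; rewrite card_ord => ->.
rewrite -(card_uniq_tuples k (mem (predC1 u))) -[RHS]cardsE.
have uE (q : seq K) : lists_path (u :: q) = all (predC1 u) q && uniq q.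
  by rewrite complete_lists_path /= all_predC has_pred1.
apply: (eq_card_rel (R := fun (t : k.+1.-tuple K) (q : k.-tuple K) =>
  tval t = u :: q)).
- move=> t /listings_fromP[q Et]; rewrite uE => uq.
  have sq : size q == k by have := size_tuple t; rewrite Et => -[->].
  by exists (Tuple sq); rewrite ?inE.
- move=> q; rewrite inE => uq; exists (cons_tuple u q) => //.
  by apply/listings_fromP; exists q => //; rewrite uE; move: uq; rewrite inE.
- by move=> t1 t2 q _ _ E1 E2; apply: val_inj; rewrite /= E1 E2.
- by move=> t q1 q2 _ _ -> [E]; apply: val_inj.
Qed.

End CompletePaths.

(** * Acyclic graphs *)

Section Acyclic.
Variable G : sgraph.
Hypothesis G_acyclic : acyclic G.
Implicit Types (x y z : G) (s p : seq G).

(** Otherwise the segment from [y] to [x], closed by the edge between them, would be a cycle, of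
    length at least 3 because [z] lies in between. *)
Lemma acyclic_no_chord s z x y : lists_path (rcons (rcons s z) x) ->
  adj x y -> y != z -> y \notin rcons (rcons s z) x.
Proof.
move=> ls xy yz; apply/negP; rewrite !(mem_rcons, inE) (negPf yz) /=.
case/orP=> [/eqP E|]; first by rewrite E adj_irr in xy.
move=> ys; case/splitPr: ys ls => a b; rewrite !rcons_cat /=.
case/andP=> us ss; suff /G_acyclic : ucycle (@adj G) (y :: rcons (rcons b z) x).
  by rewrite /= !size_rcons.
move: us; rewrite cat_uniq => /and3P[_ _ uc].
rewrite /ucycle uc andbT /= rcons_path last_rcons xy andbT.
by move/cat_sorted2: ss => [].
Qed.

(** Adjacency in the graph with [x] removed; testing both ends keeps the relation symmetric. *)
Definition avoid x : rel G := [rel a b | [&& adj a b, a != x & b != x]].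

Lemma avoid_path x y p : y != x ->
  path (avoid x) y p = path (@adj G) y p && (x \notin p).
Proof.
elim: p y => //= z p IH y yx; rewrite inE negb_or (eq_sym x z).
rewrite (_ : avoid x y z = adj y z && (z != x)); last by rewrite /avoid /= yx.
by case: (boolP (z != x)) => zx; rewrite ?andbF // andbT IH // andbA.
Qed.

(** A path between two distinct neighbours of [x] that avoids [x] would close up to a cycle through
    [x]. *)
Lemma avoid_connect_uniq x y z :
  adj x y -> adj x z -> connect (avoid x) y z -> y = z.
Proof.
move=> xy xz /connectP[p /shortenP[q yq uq _] Ez].
have yx : y != x by apply: contraTneq xy => ->; rewrite adj_irr.
move: yq; rewrite avoid_path // => /andP[yq xq].
case: q => [|w q] in yq uq xq Ez *; first by rewrite Ez.
suff /G_acyclic : ucycle (@adj G) (x :: y :: w :: q) by [].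
apply/andP; split; last by rewrite cons_uniq uq in_cons eq_sym (negPf yx) xq.
by move: yq Ez => /= /andP[-> wq] Ez; rewrite xy rcons_path wq -Ez adj_sym.
Qed.

End Acyclic.

(** * Rooted trees and their degree sum *)

Section Tree.
Variables (G : sgraph) (v : G).
Hypothesis G_tree : is_tree G.
Implicit Types (x y z : G).

Let G_acyclic : acyclic G. Proof. by case: G_tree. Qed.

Lemma tree_path x :
  exists2 p, lists_path (v :: p) & last v p = x.
Proof.
have [[_ conn] _] := G_tree; have /connectP[p /shortenP[q vq uq _] ->] := conn v x.
by exists q => //; apply/andP.
Qed.

(* [y] is the neighbour of [x] on the way to the root [v]. *)
Definition parent x y := [&& x != v, adj x y & connect (avoid x) v y].

Lemma lists_path_parent p x :
  lists_path (v :: rcons p x) -> parent x (last v p).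
Proof.
move=> /lists_path_cons[]; rewrite mem_rcons inE negb_or eq_sym => /andP[xv vp].
rewrite rcons_uniq rcons_path => /andP[xp up] /andP[vp' lx].
rewrite /parent xv adj_sym lx; apply/connectP; exists p => //.
by rewrite avoid_path 1?eq_sym // vp' xp.
Qed.

Lemma parent_uniq x y z : parent x y -> parent x z -> y = z.
Proof.
case/and3P=> _ xy vy /and3P[_ xz vz]; apply: (avoid_connect_uniq G_acyclic xy xz).
apply: connect_trans vz; rewrite (@sym_connect_sym G) // => a b /=.
by rewrite /avoid /= adj_sym [(a != x) && _]andbC.
Qed.

Lemma card_parent x : #|[set y | parent x y]| = (x != v).
Proof.
case: (eqVneq x v) => [->|xv].
  by apply: eq_card0 => y; rewrite inE /parent eqxx.
have [p] := tree_path x; case/lastP: p => [|p z] lp Ex.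
  by rewrite -Ex eqxx in xv.
rewrite last_rcons in Ex; rewrite Ex in lp => {z Ex}.
have px := lists_path_parent lp.
apply/eqP/cards1P; exists (last v p); apply/setP => y; rewrite !inE.
by apply/idP/eqP => [/parent_uniq/(_ px)|->].
Qed.

(** Take a path from [v] to [x]. If [y] is on it, the part up to [y] avoids [x], making [y] the
    parent of [x]; if not, the path extends to [y] and [x] is the parent of [y]. The equation is in
    [nat] so that it can be summed. *)
Lemma parent_adj x y : (adj x y : nat) = parent x y + parent y x.
Proof.
have adj_parent : parent x y -> adj x y by case/and3P.
have parent_or : adj x y -> parent x y || parent y x.
  move=> xy; have [p lp Ex] := tree_path x.
  case: (boolP (y \in v :: p)) => [yp|yp]; apply/orP; [left|right].
    case/lastP: p => [|p w] in lp Ex yp *.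
      by move: xy; rewrite -Ex; move: yp; rewrite inE => /eqP->; rewrite adj_irr.
    rewrite last_rcons in Ex; rewrite Ex in lp yp => {w Ex}.
    have px := lists_path_parent lp; case/and3P: (px) => xv _ _.
    rewrite /parent xv xy /=.
    have {}yp : y \in v :: p.
      move: yp; rewrite -rcons_cons mem_rcons inE => /orP[/eqP E|//].
      by rewrite E adj_irr in xy.
    have /lists_path_cons[_ + vp] := lp; rewrite rcons_uniq => /andP[xp _].
    move: vp; rewrite rcons_path => /andP[vp _].
    case/splitPl: yp vp xp => a b Ey; rewrite cat_path mem_cat => /andP[va _] /norP[xa _].
    by apply/connectP; exists a => //; rewrite avoid_path 1?eq_sym // va.
  rewrite -Ex; apply: lists_path_parent; move: lp => /andP[up vp].
  by rewrite /lists_path -rcons_cons rcons_uniq yp up /= rcons_path Ex xy andbT.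
(* Here a path from [v] to [x] avoiding [y] would, by uniqueness of parents, have [y] as its last
   vertex before [x]. *)
have parent_and : parent x y -> parent y x -> False.
  move=> pxy pyx; case/and3P: (pyx) => yv _ /connectP[p /shortenP[q vq uq _] Ex].
  move: vq; rewrite avoid_path 1?eq_sym // => /andP[vq yq].
  case/lastP: q => [|q z] in vq uq yq Ex *.
    by case/and3P: pxy; rewrite Ex eqxx.
  rewrite last_rcons in Ex; rewrite -Ex in vq uq yq => {z Ex}.
  have lq : lists_path (v :: rcons q x) by apply/andP.
  have Ey := parent_uniq pxy (lists_path_parent lq).
  have : y \in v :: q by rewrite Ey mem_last.
  rewrite inE (negPf yv) /= => yq'.
  by rewrite mem_rcons inE yq' orbT in yq.
have parent_adj_rev : parent y x -> adj x y by case/and3P; rewrite adj_sym.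
case: (parent x y) adj_parent parent_or parent_and => [/(_ isT)->|_] //.
  by case: (parent y x) => // _ /(_ isT isT).
case: (parent y x) parent_adj_rev => [/(_ isT)->|_] //.
by case: (adj x y) => // /(_ isT).
Qed.

(** Each edge is counted once from the child and once from the parent, and every vertex other than
    [v] is a child once. *)
Lemma sum_degree_tree : \sum_(x : G) degree x = (#|G|.-1).*2.
Proof.
have degE x : degree x = \sum_y (parent x y + parent y x).
  rewrite /degree -sum1dep_card big_mkcond; apply: eq_bigr => y _.
  by rewrite -parent_adj; case: (adj x y).
rewrite (eq_bigr _ (fun x _ => degE x)).
under eq_bigr do rewrite big_split.
rewrite big_split /= [X in _ + X]exchange_big /= addnn; congr _.*2.
have sumE x : \sum_y parent x y = (x != v).
  rewrite -card_parent -sum1dep_card [RHS]big_mkcond; apply: eq_bigr => y _.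
  by case: (parent x y).
rewrite (eq_bigr _ (fun x _ => sumE x)) -(cardC1 v) -sum1_card [RHS]big_mkcond.
by apply: eq_bigr => x _; rewrite !inE; case: (x == v).
Qed.

End Tree.

(** * Starlike trees *)

Lemma lists_path_rcons (G : sgraph) (x y : G) p :
  lists_path (rcons (x :: p) y) =
  [&& lists_path (x :: p), adj (last x p) y & y \notin x :: p].
Proof.
rewrite /lists_path rcons_uniq rcons_cons [sorted _ (x :: rcons _ _)]/= rcons_path.
by rewrite /=; case: (_ \notin _); case: (_ && uniq p); case: (path _ x p);
  case: (adj _ _).
Qed.

Section Starlike.
Variables (S : sgraph) (v : S).
Hypothesis S_starlike : starlike_tree v.
Implicit Types (x y z : S) (p q a b s : seq S).

Let S_tree : is_tree S. Proof. by case: S_starlike. Qed.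

Lemma root_degree : 2 < degree v.
Proof. by case: S_starlike => _ /(_ v)[_]; apply. Qed.

Lemma nonroot_degree x : x != v -> 0 < degree x <= 2.
Proof.
move=> xv; apply/andP; split; last first.
  rewrite leqNgt; apply: contra xv => d3; apply/eqP.
  by have [_ /(_ x)[/(_ d3)]] := S_starlike.
have := card_parent v S_tree x; rewrite xv => /eqP/cards1P[y /setP/(_ y)].
rewrite !inE eqxx => /and3P[_ xy _].
by apply/card_gt0P; exists y; rewrite inE.
Qed.

(** The last vertex is not the root and has positive degree, so a degree other than 1 gives a
    neighbour besides its predecessor; acyclicity makes that neighbour new. *)
Lemma extend_step p : p != [::] -> lists_path (v :: p) ->
  degree (last v p) != 1 ->
  exists y, lists_path (v :: rcons p y).
Proof.
case/lastP: p => // p x _ lp; rewrite last_rcons => d1.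
set z := last v p.
have lp' : lists_path (rcons (rcons (belast v p) z) x) by rewrite -lastI.
have xv : x != v.
  have [+ _ _] := lists_path_cons lp.
  by rewrite mem_rcons inE negb_or eq_sym => /andP[].
have [y] : exists y, y \in [set y | adj x y] :\ z.
  apply/card_gt0P; have /andP[d_gt0 _] := nonroot_degree xv.
  move: d1 d_gt0; rewrite /degree (cardsD1 z [set y | adj x y]).
  by case: (z \in _) => /=; lia.
rewrite !inE => /andP[yz xy]; exists y => //.
have yN := acyclic_no_chord S_tree.2 lp' xy yz; rewrite -lastI in yN.
by rewrite -rcons_cons lists_path_rcons lp last_rcons xy.
Qed.

Lemma extend_to_leaf p : p != [::] -> lists_path (v :: p) ->
  exists2 q, lists_path (v :: p ++ q) & degree (last v (p ++ q)) == 1.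
Proof.
(* A duplicate-free list fits in [S]; the measure is the room left for extending it. *)
have [n] := ubnP (#|S| - size p); elim: n p => // n IH p len pN lp.
case: (boolP (degree (last v p) == 1)) => [d1|d1].
  by exists [::]; rewrite cats0.
have [y lpy] := extend_step pN lp d1.
have [||q lq dq] := IH (rcons p y) _ _ lpy; last first.
- by exists (y :: q); rewrite -cat_rcons.
- by case: (p).
have /andP[/card_uniqP up _] := lpy.
have := max_card (mem (v :: rcons p y)); rewrite up /= size_rcons; move=> pS.
by apply: leq_trans (ltn_sub2l _ _) len => //; exact: ltnW.
Qed.

Lemma branch_listing p : lists_path (v :: p) -> degree (last v p) == 1 ->
  listed_subgraph (v :: p) \in branches v.
Proof.
move=> lp dp; have /andP[/card_uniqP up _] := lp.
have pS : size p < #|S| by have := max_card (mem (v :: p)); rewrite up.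
apply/bigcupP; exists (Ordinal pS) => //=.
have st : size (v :: p) == (size p).+1 by [].
apply/imsetP; exists (Tuple st) => //; rewrite inE lp (tnth_nth v) /=.
by rewrite /thead (tnth_nth v) /= eqxx /= -[nth v _ _]/(nth v (v :: p) (size (v :: p)).-1) nth_last.
Qed.

Lemma path_length_listing x p : uniq (x :: p) ->
  path_length (listed_subgraph (x :: p)) = size p.
Proof. exact: card_list_edges. Qed.

Definition leaf_listings l : {set l.+1.-tuple S} :=
  [set t in listings_from v l | degree (last v t) == 1].

Lemma num_branchesE l : num_branches v l = #|leaf_listings l|.
Proof.
rewrite /num_branches.
have -> : branches_of_length v l
    = (fun t : l.+1.-tuple S => listed_subgraph t) @: leaf_listings l.
  have E (t : l.+1.-tuple S) : (t \in leaf_listings l)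
      = [&& lists_path t, thead t == v & degree (tnth t ord_max) == 1].
    by rewrite !inE -andbA (tnth_nth v t ord_max) -nth_last size_tuple.
  by apply/setP => P; apply/imsetP/imsetP => -[t];
    move=> tP ->; exists t => //; move: tP; rewrite ?E ?inE.
rewrite card_in_imset // => t1 t2; rewrite inE => /andP[/listings_fromP[p1 E1 l1] _].
rewrite inE => /andP[/listings_fromP[p2 E2 l2] _] E; apply: val_inj.
rewrite /= E1 E2; congr (_ :: _); case/andP: l1 => u1 _; case/andP: l2 => u2 _.
by apply: list_edges_inj u1 u2 _; rewrite -E1 -E2 /list_edges E.
Qed.

(* Away from the root degrees are at most 2, so a path ending at a vertex
   that is not a leaf extends in exactly one way. *)
Lemma card_listings_fromS j : 0 < j ->
  #|listings_from v j.+1| + num_branches v j = #|listings_from v j|.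
Proof.
move=> j_gt0; rewrite num_branchesE.
rewrite -[RHS](cardsID (leaf_listings j)) addnC; congr (_ + _).
  by apply: eq_card => t; rewrite !inE; case: (_ && (thead t == v)).
have inD t : t \in listings_from v j :\: leaf_listings j ->
    (t \in listings_from v j) && (degree (last v t) != 1).
  by rewrite in_setD [t \in leaf_listings j]inE => /andP[+ tl]; rewrite tl.
apply/esym; apply: (eq_card_rel (R := fun (t : j.+1.-tuple S) (q : j.+2.-tuple S) =>
  exists y, tval q = rcons t y)).
- move=> t /inD/andP[/listings_fromP[p Et lp]]; rewrite Et => d1.
  have sp : size p = j by have := size_tuple t; rewrite Et => -[].
  have pN : p != [::] by case: (p) sp j_gt0 => // <-.
  have [y ly] := extend_step pN lp d1.
  have sq : size (v :: rcons p y) == j.+2 by rewrite /= size_rcons sp.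
  by exists (Tuple sq); [apply/listings_fromP; exists (rcons p y) | exists y].
- move=> q /listings_fromP[p Eq]; case/lastP: p Eq => [|p y] Eq lp.
    by have := size_tuple q; rewrite Eq.
  have sp : size p = j by have := size_tuple q; rewrite Eq /= size_rcons => -[].
  have st : size (v :: p) == j.+1 by rewrite /= sp.
  exists (Tuple st); last by exists y; rewrite Eq.
  move: lp; rewrite -rcons_cons lists_path_rcons => /and3P[lp ly yp].
  have tl : Tuple st \in listings_from v j by apply/listings_fromP; exists p.
  rewrite in_setD tl andbT inE tl /=; case/lastP: p {st Eq tl} sp lp ly yp => [|p x].
    by move=> E; rewrite -E in j_gt0.
  move=> _; rewrite -rcons_cons lists_path_rcons last_rcons => /and3P[_ px _] xy yN.
  (* The predecessor of [x] and [y] are two distinct neighbours, so [x] is not a leaf. *)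
  rewrite neq_ltn; apply/orP; right; rewrite /degree.
  have : [set last v p; y] \subset [set w | adj x w].
    by apply/subsetP => w; rewrite !inE => /orP[]/eqP-> //; rewrite adj_sym.
  move/subset_leq_card; rewrite cards2 => /(leq_trans _); apply.
  suff -> : last v p != y by [].
  apply: contraNneq yN => <-; rewrite -?rcons_cons mem_rcons in_cons mem_last.
  by rewrite orbT.
- move=> t1 t2 q _ _ [y1 ->] [y2 E]; apply: val_inj.
  by have [] := rcons_inj E.
- move=> t q1 q2 /listings_fromP[p1 E1 l1] /listings_fromP[p2 E2 l2] [y1 F1] [y2 F2].
  apply: val_inj; rewrite /= F1 F2; congr rcons; apply/eqP; apply: contraT => y12.
  have [w [p' Et]] : exists w p', tval t = w :: p'.
    by case: (tval t) (size_tuple t) => // w p'; exists w, p'.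
  have sp' : size p' = j by have := size_tuple t; rewrite Et => -[].
  rewrite -E1 F1 Et lists_path_rcons in l1; rewrite -E2 F2 Et lists_path_rcons in l2.
  have wv : w = v by move: E1; rewrite F1 Et => -[].
  case/lastP: p' => [|p x] in Et sp' l1 l2; first by rewrite -sp' in j_gt0.
  move: l1 l2; rewrite last_rcons wv => /and3P[lpx xy1 y1p] /and3P[_ xy2 y2p].
  have xv : x != v.
    have [+ _ _] := lists_path_cons lpx.
    by rewrite mem_rcons inE negb_or eq_sym => /andP[].
  have ux : adj x (last v p).
    by move: lpx; rewrite -rcons_cons lists_path_rcons adj_sym => /and3P[].
  have /andP[_] := nonroot_degree xv; rewrite leqNgt => /negP[].
  have neq y : y \notin v :: rcons p x -> last v p != y.
    apply: contraNneq => <-.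
    by rewrite -rcons_cons mem_rcons in_cons mem_last orbT.
  have <- : #|[set last v p; y1; y2]| = 3.
    by rewrite setUC cardsU1 !inE cards2 negb_or eq_sym neq // (eq_sym y2) y12 neq.
  apply/subset_leq_card/subsetP => z; rewrite !inE.
  by move=> /orP[/orP[]|]/eqP->.
Qed.

(** Telescopes [card_listings_fromS], starting from the [degree v] paths of length 1; the additive
    form avoids truncated subtraction. *)
Lemma card_paths_fromS_sum j : 0 < j ->
  #|paths_from v j| + \sum_(1 <= i < j) num_branches v i = degree v.
Proof.
elim: j => // -[|j] IH _.
  by rewrite big_geq // addn0 card_paths_from // card_listings_from1.
rewrite -(IH isT) big_nat_recr //= [\sum_(1 <= i < j.+1) _ + _]addnC addnA.
by rewrite !card_paths_from // card_listings_fromS.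
Qed.

(** * Path lengths bounded by branch lengths *)

Section Lengths.
Variable B1 : subgraph S.
Hypothesis B1_longest : longest_branch v B1.
Local Notation t1 := (path_length B1).
Local Notation t2 := (\max_(B in branches v :\ B1) path_length B).

Lemma size_from_root p : lists_path (v :: p) -> size p <= t1.
Proof.
case: (eqVneq p [::]) => [->|pN] // lp; have [q lq dq] := extend_to_leaf pN lp.
apply: leq_trans (B1_longest.2 _ (branch_listing lq dq)).
by rewrite path_length_listing ?size_cat ?leq_addr //; case/andP: lq.
Qed.

(** Extended to leaves, the arms become different branches, as they leave the root through different
    neighbours. At most one of them is [B1], so the other is bounded by [t2], even when lengths
    tie. *)
Lemma size_two_arms a b : a != [::] -> b != [::] ->
  lists_path (rev a ++ v :: b) -> size a + size b <= t1 + t2.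
Proof.
move=> aN bN; rewrite lists_path_rev_cat => /and3P[la lb dis].
have [a' la' da'] := extend_to_leaf aN la.
have [b' lb' db'] := extend_to_leaf bN lb.
have brA := branch_listing la' da'; have brB := branch_listing lb' db'.
have [/andP[ua _] /andP[ub _]] := (la', lb').
have sA := path_length_listing ua; have sB := path_length_listing ub.
set A := listed_subgraph _ in brA sA; set B := listed_subgraph _ in brB sB.
have AB : A != B.
  apply/eqP => /(congr1 snd) /(list_edges_inj ua ub) E.
  case: a aN E dis {la la' da' ua brA sA A} => // x a _.
  case: b bN {lb lb' db' ub brB sB B} => // y b _ [<- _].
  by rewrite /= inE eqxx.
have [A1 B1'] : path_length A <= t1 /\ path_length B <= t1.
  by split; apply: B1_longest.2.
apply: (@leq_trans (path_length A + path_length B)).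
  by rewrite sA sB !size_cat leq_add ?leq_addr.
case: (eqVneq A B1) => [EA|AB1].
  have B2 : B \in branches v :\ B1 by rewrite in_setD1 brB andbT -EA eq_sym.
  by apply: leq_add => //; exact: (leq_bigmax_cond _ B2).
have A2 : A \in branches v :\ B1 by rewrite in_setD1 brA AB1.
by rewrite addnC; apply: leq_add => //; exact: (leq_bigmax_cond _ A2).
Qed.

(* A path missing the root is met by a path from the root at an end, since an
   inner meeting point would have degree 3. *)
Lemma size_off_root s : lists_path s -> v \notin s -> size s <= t1.
Proof.
move=> ls vs; case: (eqVneq s [::]) => [->//|sN].
have [x xs] : exists x, x \in s.
  by case: (s) sN => // x s' _; exists x; rewrite mem_head.
have [p lp Ex] := tree_path v S_tree x.
have : has (mem s) p.
  apply/hasP; exists x => //.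
  have := mem_last v p; rewrite Ex inE => /predU1P[E|//].
  by rewrite -E xs in vs.
(* [y] is the first vertex of [s] met on the way from the root, so the part [q] before it is
   disjoint from [s]. *)
move=> hp; case/split_find: hp lp => y q q' ys qs lp.
have lq : lists_path (rcons (v :: q) y).
  move: lp; rewrite /lists_path -!cat_cons cat_uniq => /andP[/and3P[uq _ _]].
  by move/cat_sorted2 => [sq _]; apply/andP.
(* An arm [c] of [s] at [y] can be appended to the path from the root. The bound is strict because
   that path also has the edge entering [y]; this settles the case where [y] is an end of [s]. *)
have long c : {subset c <= s} -> lists_path (y :: c) -> size c < t1.
  move=> cs lc; have /size_from_root : lists_path (v :: rcons q y ++ c).
    rewrite cat_rcons -cat_cons -[v :: q]revK lists_path_rev_cat lc /=.
    rewrite -lists_path_rev rev_cons revK lq /=.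
    apply/hasPn => z zc /=; rewrite mem_rev inE negb_or.
    have zs := cs _ zc; apply/andP; split.
      by apply: contraNneq vs => <-.
    by apply: contra qs => zq; apply/hasP; exists z.
  by rewrite size_cat size_rcons addSn; apply: leq_trans; rewrite ltnS leq_addl.
have ws : last v q \notin s.
  have := mem_last v q; rewrite inE => /predU1P[->//|wq].
  by apply: contra qs => ws; apply/hasP; exists (last v q).
case/splitPr: ys ls vs long ws {Ex qs sN xs} => a b.
rewrite -(revK a); move: (rev a) => {}a.
rewrite lists_path_rev_cat => /and3P[la lb dis] vs long ws.
have sa : {subset a <= rev a ++ y :: b} by move=> z za; rewrite mem_cat mem_rev za.
have sb : {subset b <= rev a ++ y :: b}.
  by move=> z zb; rewrite mem_cat inE zb !orbT.
rewrite size_cat size_rev /=.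
have [a_nil|[a0 a0a ya]] : a = [::] \/ exists2 a0, a0 \in a & adj y a0.
  case: (a) la => [|a0 a' /lists_path_cons[_ _ /andP[ya _]]]; first by left.
  by right; exists a0; rewrite ?mem_head.
  by rewrite a_nil add0n; exact: long.
have [b_nil|[b0 b0b yb]] : b = [::] \/ exists2 b0, b0 \in b & adj y b0.
  case: (b) lb => [|b0 b' /lists_path_cons[_ _ /andP[yb _]]]; first by left.
  by right; exists b0; rewrite ?mem_head.
  by rewrite b_nil addn1; exact: long.
have yv : y != v by apply: contraNneq vs => <-; rewrite mem_cat inE eqxx orbT.
have /andP[_] := nonroot_degree yv; rewrite leqNgt => /negP[].
have yw : adj y (last v q).
  by move: lq; rewrite lists_path_rcons adj_sym => /and3P[].
have ab : a0 != b0.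
  by apply: contraNneq dis => E; apply/hasP; exists b0; rewrite // -E.
have wa : last v q != a0 by apply: contraNneq ws => ->; exact: sa.
have wb : last v q != b0 by apply: contraNneq ws => ->; exact: sb.
have <- : #|[set last v q; a0; b0]| = 3.
  by rewrite setUC cardsU1 !inE cards2 negb_or !(eq_sym b0) wb ab wa.
apply/subset_leq_card/subsetP => z; rewrite !inE.
by move=> /orP[/orP[]|]/eqP->.
Qed.

Lemma num_paths_starlike_eq0 h : t1 + t2 < h -> num_paths S h = 0.
Proof.
move=> lth; apply/eqP; rewrite /num_paths cards_eq0; apply/eqP/setP => P.
rewrite inE; apply/negP => /imsetP[t lt _].
have {}lt : lists_path t by move: lt; rewrite inE.
(* [size] counts vertices, hence the successor. The root may be off the path, at an end of it, or
   inside. *)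
suff : size t <= (t1 + t2).+1 by rewrite size_tuple ltnS leqNgt lth.
case: (boolP (v \in tval t)) => [vt|vt]; last first.
  apply: leq_trans (size_off_root lt vt) _; exact: leqW (leq_addr _ _).
case/splitPr: vt lt => a b; rewrite -(revK a); move: (rev a) => {}a lt.
rewrite size_cat size_rev /= addnS ltnS.
case: (eqVneq a [::]) lt => [->|aN] lt.
  by apply: leq_trans (size_from_root lt) (leq_addr _ _).
case: (eqVneq b [::]) lt => [->|bN] lt; last exact: size_two_arms.
rewrite addn0; apply: leq_trans (leq_addr _ _); apply: size_from_root.
by rewrite lists_path_rev_cat in lt; case/and3P: lt.
Qed.

Lemma paths_from_root_eq0 j : t1 < j -> #|paths_from v j| = 0.
Proof.
move=> ltj; rewrite card_paths_from; last exact: leq_ltn_trans ltj.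
apply: eq_card0 => t; apply/negP => /listings_fromP[p Et /size_from_root].
by have := size_tuple t; rewrite Et => -[->]; rewrite leqNgt ltj.
Qed.

End Lengths.

(** Away from the root the degree [d] is 1 or 2, and then [d * d.-1 + 2 = d.*2], which reduces the
    quadratic sum to the degree sum. *)
Lemma sum_degree_pred :
  \sum_(x : S) degree x * (degree x).-1 + (degree v).*2
  = degree v * (degree v).-1 + (#|S|.-1).*2.
Proof.
have sdeg := sum_degree_tree v S_tree.
rewrite (bigD1 v) //= in sdeg; rewrite (bigD1 v) //= -addnA; congr (_ + _).
have E x : x != v -> degree x * (degree x).-1 + 2 = (degree x).*2.
  by move/nonroot_degree; case: (degree x) => [|[|[]]].
have : \sum_(x | x != v) degree x * (degree x).-1 + \sum_(x : S | x != v) 2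
    = (\sum_(x | x != v) degree x).*2.
  rewrite -big_split -mul2n big_distrr; apply: eq_bigr => x xv /=.
  by rewrite E // mul2n.
have -> : \sum_(x : S | x != v) 2 = #|S|.-1 * 2.
  rewrite sum_nat_const; congr (_ * _).
  by rewrite -(cardC1 v).
(* [A] and [B] stand for the quadratic and the linear sum away from the root, [d] for the root
   degree, [N] for the number of edges; what remains is linear. *)
have double_count A B d N : d + B = N.*2 -> A + N * 2 = B.*2 -> A + d.*2 = N.*2.
  by lia.
exact: double_count sdeg.
Qed.

End Starlike.

(** * The formulas over the rationals *)

Import Order.TTheory GRing.Theory Num.Theory.
Local Open Scope ring_scope.

(** Valid for every [k]: beyond [n] both sides vanish, the product through its factor at [i = n]. *)
Lemma natr_ffact (R : pzRingType) (n k : nat) :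
  (n ^_ k)%:R = \prod_(0 <= i < k) (n%:R - i%:R) :> R.
Proof.
elim: k => [|k IH]; first by rewrite big_geq.
rewrite big_nat_recr //= -IH ffactnSr natrM.
have [kn|nk] := leqP k n; first by rewrite natrB.
by rewrite ffact_small // !mul0r.
Qed.

(** Cuts the convolution of [g] and [f] at the point where one factor starts to vanish. *)
Lemma sum_nat_truncate (V : nmodType) (F : nat -> V) (a b : nat) :
  (0 < a <= b)%N -> (forall k, (a <= k < b)%N -> F k = 0) ->
  \sum_(1 <= k < b) F k = \sum_(1 <= k < a) F k.
Proof.
case/andP=> a_gt0 ab F0; rewrite (big_cat_nat a_gt0 ab) /=.
by rewrite [X in _ + X]big_nat_cond [X in _ + X]big1 ?addr0 // => k /andP[/F0].
Qed.

Lemma card_coalescence (G H : sgraph) (u : G) (v : H) :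
  #|coalescence u v| = (#|G| + #|H|.-1)%N.
Proof.
rewrite -(cardC1 v) -(card_sig (predC1 v)) -card_sum.
exact: eq_card.
Qed.

Theorem theorem12 (n1 n2 : nat) (u0 : complete_graph n1)
    (S : sgraph) (v0 : S) (B1 : subgraph S)
    (S_starlike : starlike_tree v0) (S_order : #|S| = n2)
    (B1_longest : longest_branch v0 B1) :
  let K := complete_graph n1 in
  let G := coalescence u0 v0 in
  let P (H : sgraph) (h : nat) : rat := (num_paths H h)%:R in
  let n : rat := n1%:R + n2%:R - 1 in
  let m : nat := degree v0 in
  let t1 : nat := path_length B1 in
  let t2 : nat := (\max_(B in branches v0 :\ B1) path_length B)%N in
  let g (k : nat) : rat := \prod_(1 <= i < k.+1) (n1%:R - i%:R) in
  let f (j : nat) : rat :=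
    m%:R - \sum_(1 <= i < j) (num_branches v0 i)%:R in
  (* g and f count the paths ending at the merged vertex *)
  (forall k : nat, (1 <= k)%N ->
     #|paths_from (u0 : K) k|%:R = g k /\ #|paths_from v0 k|%:R = f k) /\
  (* (0) *)
  [/\ P G 0%N = n1%:R + n2%:R - 1,
      P G 1%N = n1%:R * (n1%:R - 1) / 2 + n2%:R - 1 &
      P G 2%N = 1 / 2 * m%:R ^+ 2 + (n1%:R - 5 / 2) * m%:R
                + 1 / 2 * n1%:R ^+ 3 - 3 / 2 * n1%:R ^+ 2 + n] /\
  forall h : nat, (3 <= h)%N ->
    (h <= maxn (t1 + n1 - 1) (t1 + t2))%N ->
  [/\ (* (1) *)
      (t2 < n1 - 1)%N -> (n1 - 1 <= t1)%N -> (t1 < t1 + t2)%N ->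
      [/\ (3 <= h <= n1 - 1)%N ->
            P G h = P K h + P S h + \sum_(1 <= k < h) g k * f (h - k)%N,
          (n1 <= h <= t1 + t2)%N ->
            P G h = P S h + \sum_(1 <= k < n1) g k * f (h - k)%N &
          (t1 + t2 + 1 <= h <= t1 + n1 - 1)%N ->
            P G h = \sum_(1 <= k < n1) g k * f (h - k)%N],
      (* (2) *)
      (t2 <= t1)%N -> (t1 < n1 - 1)%N -> (n1 - 1 <= t1 + t2)%N ->
      [/\ (3 <= h <= t1)%N ->
            P G h = P K h + P S h + \sum_(1 <= k < h) f k * g (h - k)%N,
          (t1 + 1 <= h <= n1 - 1)%N ->
            P G h = P K h + P S h + \sum_(1 <= k < t1.+1) f k * g (h - k)%N,
          (n1 <= h <= t1 + t2)%N ->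
            P G h = P S h + \sum_(1 <= k < t1.+1) f k * g (h - k)%N &
          (t1 + t2 + 1 <= h <= t1 + n1 - 1)%N ->
            P G h = \sum_(1 <= k < t1.+1) f k * g (h - k)%N],
      (* (3) *)
      (t1 + t2 < n1 - 1)%N ->
      [/\ (3 <= h <= t1)%N ->
            P G h = P K h + P S h + \sum_(1 <= k < h) f k * g (h - k)%N,
          (t1 + 1 <= h <= t1 + t2)%N ->
            P G h = P K h + P S h + \sum_(1 <= k < t1.+1) f k * g (h - k)%N,
          (t1 + t2 + 1 <= h <= n1 - 1)%N ->
            P G h = P K h + \sum_(1 <= k < t1.+1) f k * g (h - k)%N &
          (n1 <= h <= t1 + n1 - 1)%N ->
            P G h = \sum_(1 <= k < t1.+1) f k * g (h - k)%N] &
      (* (4) *)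
      (n1 - 1 <= t2)%N ->
      [/\ (3 <= h <= n1 - 1)%N ->
            P G h = P K h + P S h + \sum_(1 <= k < h) g k * f (h - k)%N,
          (n1 <= h <= t1 + n1 - 1)%N ->
            P G h = P S h + \sum_(1 <= k < n1) g k * f (h - k)%N &
          (t1 + n1 <= h <= t1 + t2)%N ->
            P G h = P S h]].
Proof.
move=> K G P n m t1 t2 g f.
(* [u0] is an element of ['I_n1], so the subtraction in [n1 - 1] is not truncated. *)
have n1_gt0 : (0 < n1)%N by case: (u0) => i; apply: leq_trans.
have n2_gt0 : (0 < n2)%N by rewrite -S_order; apply/card_gt0P; exists v0.
have gE k : (1 <= k)%N -> #|paths_from (u0 : K) k|%:R = g k.
  move=> k_gt0; rewrite card_paths_from_complete // natr_ffact /g big_add1 /=.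
  by apply: eq_bigr => i _; rewrite -[in RHS](prednK n1_gt0) !mulrS; ring.
have fE k : (1 <= k)%N -> #|paths_from v0 k|%:R = f k.
  move=> k_gt0; rewrite /f /m -(card_paths_fromS_sum S_starlike k_gt0) natrD.
  by rewrite natr_sum addrK.
have g0 k : (n1 <= k)%N -> g k = 0.
  move=> nk; rewrite -gE ?(leq_trans n1_gt0) //.
  by rewrite card_paths_from_complete ?(leq_trans n1_gt0) // ffact_small ?prednK.
(* Read off the count of paths, so the sum of the [num_branches v0 i] need not be evaluated. *)
have f0 k : (t1 < k)%N -> f k = 0.
  move=> tk; rewrite -fE; last exact: leq_ltn_trans tk.
  by rewrite (paths_from_root_eq0 S_starlike B1_longest).
have PK0 h : (n1 <= h)%N -> P K h = 0.
  by move=> nh; rewrite /P num_paths_ge_card // card_ord.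
have PS0 h : (t1 + t2 < h)%N -> P S h = 0.
  by move=> th; rewrite /P (num_paths_starlike_eq0 S_starlike B1_longest).
have PG h : (0 < h)%N ->
    P G h = P K h + P S h + \sum_(1 <= k < h) g k * f (h - k)%N.
  move=> h_gt0; rewrite /P num_paths_coalescence // !natrD natr_sum.
  congr (_ + _); apply: eq_big_nat => k /andP[k_gt0 kh].
  by rewrite natrM gE // fE // subn_gt0.
(* Replacing [k] by [h - k] lets the factor with the shorter support carry the summation index in
   each case. *)
have sumC h : \sum_(1 <= k < h) g k * f (h - k)%N
    = \sum_(1 <= k < h) f k * g (h - k)%N.
  rewrite big_nat_rev; apply: eq_big_nat => k /andP[k_gt0 kh].
  by rewrite add1n subSS subKn ?(ltnW kh) // mulrC.
have sum_g h : (n1 <= h)%N ->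
    \sum_(1 <= k < h) g k * f (h - k)%N = \sum_(1 <= k < n1) g k * f (h - k)%N.
  move=> nh; apply: sum_nat_truncate; first by rewrite n1_gt0.
  by move=> k /andP[nk _]; rewrite g0 // mul0r.
have sum_f h : (t1 < h)%N ->
    \sum_(1 <= k < h) g k * f (h - k)%N = \sum_(1 <= k < t1.+1) f k * g (h - k)%N.
  move=> th; rewrite sumC; apply: sum_nat_truncate; first by [].
  by move=> k /andP[tk _]; rewrite f0 // mul0r.
have num_half_listings (H : sgraph) h : (0 < h)%N -> P H h = #|listings H h|%:R / 2.
  by move=> h_gt0; rewrite card_listings // -muln2 natrM mulfK ?pnatr_eq0.
have predE k : (0 < k)%N -> k.-1%:R = k%:R - 1 :> rat.
  by move=> k_gt0; rewrite -subn1 natrB.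
split; [by move=> k k_gt0; split; [exact: gE | exact: fE] | split].
- split.
  + rewrite /P num_paths0 card_coalescence card_ord S_order natrD predE //.
    by ring.
  + rewrite PG // big_geq // addr0 !num_half_listings // card_listings_complete.
    rewrite card_listings1 (sum_degree_tree v0 S_starlike.1) S_order natr_ffact.
    by rewrite -muln2 natrM predE // !big_nat_recr //= big_geq //; field.
  (* The only cross term is [g 1 * f 1], that is [(n1 - 1) * m]. *)
  + rewrite PG // big_nat1 -fE // -gE // card_paths_from_complete // ffactn1.
    rewrite card_paths_from // card_listings_from1 !num_half_listings //.
    rewrite card_listings_complete natr_ffact predE //.
    have := sum_degree_pred S_starlike; rewrite -card_listings2 S_order.
    move/(congr1 (fun k => k%:R : rat)); rewrite !natrD -!muln2 !natrM.
    rewrite !predE ?(leq_trans _ (root_degree S_starlike)) // -/m => E2.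
    have {E2} -> : #|listings S 2|%:R
        = m%:R * (m%:R - 1) + (n2%:R - 1) * 2 - m%:R * 2 :> rat.
      by rewrite -E2 addrK.
    by rewrite !big_nat_recr //= big_geq // /n; field.
- move=> h h_ge3 h_le; have h_gt0 : (0 < h)%N by apply: leq_trans h_ge3.
  split.
  + move=> t2n nt t12; split=> /andP[lo hi]; rewrite PG //.
    * by rewrite PK0 // add0r sum_g.
    * have nh : (n1 <= h)%N by lia.
      by rewrite PK0 // PS0 ?sum_g // ?add0r //; lia.
  + move=> t21 tn nt; split=> /andP[lo hi]; rewrite PG //.
    * by rewrite sumC.
    * by rewrite sum_f //; lia.
    * by rewrite PK0 // add0r sum_f //; lia.
    * by rewrite PK0 ?PS0 ?sum_f ?add0r //; lia.
  + move=> tn; split=> /andP[lo hi]; rewrite PG //.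
    * by rewrite sumC.
    * by rewrite sum_f //; lia.
    * by rewrite PS0 ?addr0 ?sum_f //; lia.
    * by rewrite PK0 ?PS0 ?sum_f ?add0r //; lia.
  + move=> nt; split=> /andP[lo hi]; rewrite PG //.
    * by rewrite PK0 // add0r sum_g.
    * have nh : (n1 <= h)%N by lia.
      (* For [k < n1] and [t1 + n1 <= h] the index [h - k] exceeds [t1], so every cross term
         vanishes. *)
      rewrite PK0 // add0r sum_g // big_nat_cond big1 ?addr0 // => k.
      by rewrite andbT => /andP[_ kn]; rewrite f0 ?mulr0 //; lia.
Qed.
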